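(* Let $\mathcal{C}$ be a $d$-uniform clutter with incidence matrix $A$. Suppose that $\mathcal{C}$ has a perfect matching and that the set covering polyhedron $Q(A)$ is integral. Then $\mathcal{C}$ is vertex critical.
   Context: A clutter $\mathcal{C}$ with finite vertex set $X=\{x_1,\ldots,x_n\}$ is a family of subsets of $X$ (called edges), none of which is included in another. Standing assumption: $\mathcal{C}$ has no isolated vertices, i.e., each vertex lies in at least one edge. $\mathcal{C}$ is $d$-uniform if every edge has exactly $d$ vertices. If $f_1,\ldots,f_q$ are the edges, the incidence matrix $A$ is the $n\times q$ matrix whose columns are the characteristic vectors $v_k=\sum_{x_i\in f_k}e_i\in\{0,1\}^n$. The set covering polyhedron is $Q(A)=\{x\in\mathbb{R}^n \mid x\geq 0,\ xA\geq \mathbf{1}\}$ with $\mathbf{1}=(1,\ldots,1)$; it is integral if all its vertices have integer coordinates. A minimal vertex cover of $\mathcal{C}$ is a subset $C\subset X$ meeting every edge and minimal under inclusion with this property; $\alpha_0(\mathcal{C})$ is the smallest cardinality of a minimal vertex cover. A perfect matching is a set of pairwise disjoint edges whose union is $X$. $\mathcal{C}\setminus\{x_i\}$ denotes the clutter obtained by deleting the vertex $x_i$ and removing all edges containing $x_i$. $\mathcal{C}$ is vertex critical if $\alpha_0(\mathcal{C}\setminus\{x_i\})<\alpha_0(\mathcal{C})$ for all $i=1,\ldots,n$. *)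

(* Defs.v *)
From HB Require Import structures.
From mathcomp Require Import all_boot all_order all_algebra.
From mathcomp Require Import reals.

Set Implicit Arguments.
Unset Strict Implicit.
Unset Printing Implicit Defensive.

Import Order.TTheory GRing.Theory Num.Theory.

Section Polyhedra.
Local Open Scope ring_scope.
Variables (R : realType) (n : nat).
Implicit Types (P F : 'rV[R]_n -> Prop) (x y : 'rV[R]_n).

(* [F] is cut out of [P] by the inequality [b <= y *m c], valid on [P].
   With [c = 0], [F] is [P] itself or the empty face. *)
Definition face P F : Prop :=
  exists (c : 'cV[R]_n) (b : R),
    (forall y, P y -> b <= (y *m c) 0 0) /\
    (forall y, F y <-> P y /\ (y *m c) 0 0 = b).

(* A vertex is a face consisting of a single point. *)
Definition polyhedron_vertex P x : Prop := face P (fun y => y = x).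

Definition integral_polyhedron P : Prop :=
  forall x, polyhedron_vertex P x -> forall i, x 0 i \is a Num.int.

Definition set_covering_polyhedron q (A : 'M[R]_(n, q)) : 'rV[R]_n -> Prop :=
  fun x => (forall i, 0 <= x 0 i) /\ (forall k, 1 <= (x *m A) 0 k).

End Polyhedra.

(* The vertex set is a subset of an ambient finite type, so that deleting a
   vertex yields a clutter over the same type. *)
Record clutter (T : finType) := Clutter {
  vertices : {set T};
  edges : {set {set T}};
  edge_sub : {in edges, forall e : {set T}, e \subset vertices};
  edge_antichain : {in edges &, forall e f : {set T}, e \subset f -> e = f}
}.

Section Clutters.
Variable T : finType.
Implicit Types (C : clutter T) (K : {set T}) (x : T).

Definition no_isolated_vertices C : Prop :=
  forall x, x \in vertices C -> exists2 e, e \in edges C & x \in e.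

Definition uniform (d : nat) C : Prop :=
  forall e, e \in edges C -> #|e| = d.

(* Vertices and edges are numbered by their rank in [enum]. *)
Definition incidence_matrix (R : realType) C :
    'M[R]_(#|vertices C|, #|edges C|) :=
  (\matrix_(i, k) (enum_val i \in (enum_val k : {set T}))%:R)%R.

Definition vertex_cover C K : bool :=
  (K \subset vertices C) && [forall e in edges C, K :&: e != set0].

Definition minimal_vertex_cover C K : bool := minset (vertex_cover C) K.

(* Covers have at most [#|vertices C|] elements, so the default value of the
   minimum matters only when there is no cover, i.e. when [set0] is an edge. *)
Definition alpha0 C : nat :=
  \big[minn/#|vertices C|]_(K : {set T} | minimal_vertex_cover C K) #|K|.

Definition has_perfect_matching C : Prop :=
  exists M : {set {set T}},
    [/\ M \subset edges C, trivIset M & cover M = vertices C].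

Definition del_edges C x : {set {set T}} := [set e in edges C | x \notin e].

Lemma del_edge_sub C x :
  {in del_edges C x, forall e : {set T}, e \subset vertices C :\ x}.
Proof.
by move=> e; rewrite inE subsetD1 => /andP[/edge_sub -> ->].
Qed.

Lemma del_edge_antichain C x :
  {in del_edges C x &, forall e f : {set T}, e \subset f -> e = f}.
Proof.
move=> e f; rewrite !inE => /andP[eC _] /andP[fC _].
exact: edge_antichain eC fC.
Qed.

Definition del_vertex C x : clutter T :=
  Clutter (@del_edge_sub C x) (@del_edge_antichain C x).

Definition vertex_critical C : Prop :=
  forall x, x \in vertices C -> alpha0 (del_vertex C x) < alpha0 C.

End Clutters.

(* Main.v *)
Require Import Defs.
From HB Require Import structures.
From mathcomp Require Import all_boot all_order all_algebra.
From mathcomp Require Import reals.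

(** Uniformity makes every edge constraint tight at the point (1/d, ..., 1/d)
    of Q(A), and its minimal face is bounded. Hence for each x that face has a
    vertex whose x-coordinate is at least 1/d. This vertex is integral, so its
    support is a vertex cover containing x and meeting every edge exactly once.
    A perfect matching M forces such a cover to have #|M| elements, whereas
    every cover has at least #|M|; removing x gives a smaller cover of the
    clutter with x deleted. *)

Import Order.TTheory GRing.Theory Num.Theory.

Section Vertices.
Local Open Scope ring_scope.
Variables (R : realType) (n p : nat) (M : 'M[R]_(n, p)) (b : 'rV[R]_p).
Variable P : 'rV[R]_n -> Prop.
Hypothesis PE : forall x, P x <-> forall k, b 0 k <= (x *m M) 0 k.

Let tight (x : 'rV[R]_n) k : bool := (x *m M) 0 k == b 0 k.

(** The sum of the constraints tight at [y] is valid on [P] and exposes [y]: equality at [x] forces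
    each of them to be tight at [x], so [x - y] is annihilated by all of them. *)
Lemma tight_vertex (y : 'rV[R]_n) : P y ->
    (forall z : 'rV[R]_n, (forall k, tight y k -> (z *m M) 0 k = 0) -> z = 0) ->
  polyhedron_vertex P y.
Proof.
move=> Py free_y.
pose c : 'cV[R]_n := M *m \col_k (tight y k)%:R.
have cE x : (x *m c) 0 0 = \sum_(k | tight y k) (x *m M) 0 k.
  rewrite mulmxA mxE [RHS]big_mkcond; apply: eq_bigr => k _.
  by rewrite [X in _ * X]mxE mulr_natr mulrb.
exists c, (\sum_(k | tight y k) b 0 k); split=> x.
  by move=> /PE Px; rewrite cE ler_sum.
split=> [-> | [/PE Px]]; first by split=> //; rewrite cE; apply/eq_bigr => k /eqP.
rewrite cE => /eqP; rewrite -subr_eq0 -sumrB => /eqP sum0.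
have x_tight := psumr_eq0P (fun k _ => etrans (subr_ge0 _ _) (Px k)) sum0.
apply/subr0_eq/free_y => k tk.
have /eqP yk := tk; have := x_tight k tk.
by rewrite mulmxBl !mxE -yk mxE.
Qed.

(** The second hypothesis says that the minimal face containing [y] has no nonzero recession
    direction. One walks inside this face without decreasing [u]; each step makes a further
    constraint tight, until no free direction is left. *)
Lemma bounded_face_vertex (u : 'cV[R]_n) (y : 'rV[R]_n) : P y ->
    (forall z : 'rV[R]_n, (forall k, tight y k -> (z *m M) 0 k = 0) ->
       (forall k, 0 <= (z *m M) 0 k) -> z = 0) ->
  exists v, [/\ P v, polyhedron_vertex P v,
    forall k, tight y k -> tight v k & (y *m u) 0 0 <= (v *m u) 0 0].
Proof.
have [s] := ubnP #|[pred k | ~~ tight y k]|.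
elim: s y => // s IHs y ley Py bnd.
(* [N] zeroes the columns of [M] not tight at [y], so its kernel consists of the directions along
   which tight constraints stay tight. *)
pose N := M *m diag_mx (\row_k (tight y k)%:R).
have NE (z : 'rV[R]_n) k : (z *m N) 0 k = (z *m M) 0 k * (tight y k)%:R.
  by rewrite mulmxA mul_mx_diag !mxE.
have [ker0 | /rowV0Pn[z0 /sub_kermxP zN0 z0_neq0]] := eqVneq (kermx N) 0.
  exists y; split=> //; apply: tight_vertex => // z z_tight.
  apply/eqP; rewrite -submx0 -ker0; apply/sub_kermxP/rowP => k.
  rewrite NE [RHS]mxE; case: (boolP (tight y k)) => [/z_tight -> | _].
    by rewrite mul0r.
  by rewrite mulr0.
have [z [z_neq0 z_tight zu_ge0]] : exists z : 'rV[R]_n,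
    [/\ z != 0, forall k, tight y k -> (z *m M) 0 k = 0 & 0 <= (z *m u) 0 0].
  have z0_tight k : tight y k -> (z0 *m M) 0 k = 0.
    by move=> tk; have := NE z0 k; rewrite zN0 tk mulr1 [LHS]mxE.
  have [le0 | lt0] := leP 0 ((z0 *m u) 0 0); first by exists z0.
  exists (- z0); split; first by rewrite oppr_eq0.
    by move=> k /z0_tight zk; rewrite mulNmx [LHS]mxE zk oppr0.
  by rewrite mulNmx mxE oppr_ge0 ltW.
(* Otherwise [z] would be a nonzero recession direction of the face. *)
have [k0 k0_neg] : exists k, (z *m M) 0 k < 0.
  apply/existsP; rewrite -[X in is_true X]negbK negb_exists.
  apply: contraNN z_neq0 => /forallP z_ge0; apply/eqP/bnd => // k.
  by rewrite leNgt.
(* The step along [z] at which the constraint [k] becomes tight. *)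
pose r k := (b 0 k - (y *m M) 0 k) / (z *m M) 0 k.
(* Ratio test: stopping at the first constraint reached keeps the new point in [P]. *)
case: (@arg_minP _ _ _ k0 (fun k => (z *m M) 0 k < 0) r k0_neg) =>
  k1 k1_neg r_min.
have /PE y_ge := Py.
have r_ge0 : 0 <= r k1 by rewrite mulr_le0 ?invr_le0 ?subr_le0 // ltW.
pose y1 := y + r k1 *: z.
have y1E k : (y1 *m M) 0 k = (y *m M) 0 k + r k1 * (z *m M) 0 k.
  by rewrite mulmxDl -scalemxAl [LHS]mxE [X in _ + X]mxE.
have y1_tight k : tight y k -> tight y1 k.
  by move=> tk; rewrite /tight y1E z_tight // mulr0 addr0.
have k1_tight : tight y1 k1.
  by rewrite /tight y1E divfK ?ltr0_neq0 // addrC subrK.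
have k1_ntight : ~~ tight y k1.
  by apply/negP => /z_tight zk1; rewrite zk1 ltxx in k1_neg.
have Py1 : P y1.
  apply/PE => k; rewrite y1E.
  have [z_ge0 | z_lt0] := leP 0 ((z *m M) 0 k).
    by apply: le_trans (y_ge k) _; rewrite lerDl mulr_ge0.
  by rewrite -lerBlDl -ler_ndivlMr // r_min.
case: (IHs y1) => //.
- move: ley; rewrite ltnS; apply: leq_trans; apply/proper_card/properP; split.
    by apply/subsetP => k; rewrite !inE; apply/contraNN/y1_tight.
  by exists k1; rewrite !inE // k1_tight.
- by move=> w w_tight; apply: bnd => k /y1_tight/w_tight.
move=> v [Pv vv v_tight v_ge]; exists v; split=> // [k /y1_tight/v_tight //|].
apply: le_trans v_ge; rewrite mulmxDl -scalemxAl [leRHS]mxE lerDl mxE.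
exact: mulr_ge0.
Qed.

End Vertices.

Section Covers.
Variables (T : finType) (C : clutter T).
Implicit Types (K e : {set T}) (M : {set {set T}}).

Lemma card_trivIset_cover K M : trivIset M -> K \subset cover M ->
  #|K| = \sum_(e in M) #|K :&: e|.
Proof.
move=> tM KM.
rewrite -sum1_card -[in LHS](setIidPr KM).
under eq_bigl do rewrite inE.
rewrite big_trivIset_cond //; apply: eq_bigr => e _; rewrite -sum1_card.
by apply: eq_bigl => x; rewrite inE andbC.
Qed.

Lemma alpha0_le K : vertex_cover C K -> alpha0 C <= #|K|.
Proof.
move=> /minset_exists[L minL LK]; exact: (@bigmin_inf _ nat) minL (subset_leq_card LK).
Qed.

Lemma matching_le_alpha0 M : set0 \notin edges C ->
  M \subset edges C -> trivIset M -> cover M = vertices C -> #|M| <= alpha0 C.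
Proof.
move=> C0 MC tM cM.
have le_cover K : vertex_cover C K -> #|M| <= #|K|.
  case/andP=> KV /forall_inP K_meets.
  rewrite (@card_trivIset_cover K M) ?cM // -sum1_card leq_sum // => e eM.
  by rewrite card_gt0 K_meets // (subsetP MC).
rewrite /alpha0; elim/big_rec: _ => [|K m /minsetp/le_cover leK lem].
  (* The default value in [alpha0] is the size of the cover by all vertices, which is a cover since
     no edge is empty. *)
  apply: le_cover; apply/andP; split=> //; apply/forall_inP => e eC.
  by rewrite (setIidPr (edge_sub eC)); apply: contraNneq C0 => <-.
by rewrite leq_min leK.
Qed.

End Covers.

Section Fractional.
Local Open Scope ring_scope.
Variables (R : realType) (T : finType) (C : clutter T).
Local Notation A := (incidence_matrix R C).
Local Notation Q := (set_covering_polyhedron A).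

Lemma mul_incidence (x : 'rV[R]_#|vertices C|) k :
  (x *m A) 0 k = \sum_(i | enum_val i \in (enum_val k : {set T})) x 0 i.
Proof.
rewrite mxE [RHS]big_mkcond; apply: eq_bigr => i _.
by rewrite mxE mulr_natr mulrb.
Qed.

(** Nonnegativity becomes an identity block, giving the single system that [bounded_face_vertex]
    takes. *)
Lemma set_covering_ineq (x : 'rV[R]_#|vertices C|) :
  Q x <-> forall k, (row_mx 0 (const_mx 1) : 'rV_(_ + _)) 0 k
                    <= (x *m row_mx 1%:M A) 0 k.
Proof.
rewrite mul_mx_row mulmx1; split=> [[x_ge0 xA] k | xk].
  by case: (split_ordP k) => j ->; rewrite ?row_mxEl ?row_mxEr [leLHS]mxE.
split=> [i | k].
  by have := xk (lshift _ i); rewrite !row_mxEl [leLHS]mxE.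
by have := xk (rshift _ k); rewrite !row_mxEr [leLHS]mxE.
Qed.

Lemma exact_cover_through d x : no_isolated_vertices C -> uniform d C ->
    integral_polyhedron Q -> x \in vertices C ->
  exists K : {set T}, [/\ K \subset vertices C, x \in K &
    forall e, e \in edges C -> #|K :&: e| = 1%N].
Proof.
move=> noiso unif integral xV.
have d_gt0 : (0 < d)%N.
  by have [e /unif <- xe] := noiso x xV; apply/card_gt0P; exists x.
pose y : 'rV[R]_#|vertices C| := const_mx d%:R^-1.
have yA k : (y *m A) 0 k = 1.
  rewrite mul_incidence (eq_bigr (fun=> d%:R^-1)) => [|i _]; last by rewrite mxE.
  rewrite sumr_const.
  have -> : #|[pred i : 'I_#|vertices C| | enum_val i \in (enum_val k : {set T})]| = d.
    rewrite -(unif _ (enum_valP k)) -[in RHS](setIidPr (edge_sub (enum_valP k))).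
    rewrite -[RHS]sum1_card; under [RHS]eq_bigl do rewrite inE.
    rewrite big_enum_val_cond.
    by rewrite sum1_card; apply: eq_card.
  by rewrite -[_ *+ d]mulr_natr mulVf // pnatr_eq0 -lt0n.
have Qy : Q y.
  by split=> [i | k]; rewrite ?yA // mxE invr_ge0 ler0n.
pose i0 := enum_rank_in xV x.
have i0E : enum_val i0 = x by rewrite enum_rankK_in.
have [z z_tight z_ge0|v [Qv vert_v v_tight v_i0]] :=
    bounded_face_vertex _ _ _ _ _ _ set_covering_ineq (delta_mx i0 0) y Qy.
  (* A recession direction [z] is nonnegative and sums to zero over each edge; as every vertex lies
     in an edge, [z] vanishes. *)
  move: z_ge0 z_tight; rewrite mul_mx_row mulmx1 => z_ge0 z_tight.
  have zi i : 0 <= z 0 i by have := z_ge0 (lshift _ i); rewrite row_mxEl.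
  apply/rowP => i; rewrite [RHS]mxE.
  have [e eC ie] := noiso _ (enum_valP i).
  have zA : (z *m A) 0 (enum_rank_in eC e) = 0.
    have := z_tight (rshift _ (enum_rank_in eC e)).
    by rewrite mul_mx_row !row_mxEr yA mxE; apply.
  move: zA; rewrite mul_incidence enum_rankK_in // => zA.
  exact: (psumr_eq0P (fun j _ => zi j) zA).
have [v_ge0 _] := Qv.
have vA k : (v *m A) 0 k = 1.
  have := v_tight (rshift _ k); rewrite !mul_mx_row !row_mxEr yA [const_mx _ _ _]mxE.
  by move=> /(_ (eqxx _))/eqP.
have v1 i : v 0 i != 0 -> 1 <= v 0 i.
  move=> vi; have := norm_intr_ge1 (integral v vert_v i) vi.
  by rewrite ger0_norm.
have vi0 : v 0 i0 != 0.
  move: v_i0; rewrite -!colE !mxE => le_v.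
  by rewrite gt_eqF // (lt_le_trans _ le_v) // invr_gt0 ltr0n.
exists [set enum_val i | i : 'I_#|vertices C| & v 0 i != 0]; split.
- by apply/subsetP => _ /imsetP[i _ ->]; apply: enum_valP.
- by rewrite -i0E imset_f ?inE.
move=> e eC.
pose B := [set i : 'I_#|vertices C| | (v 0 i != 0) && (enum_val i \in e)].
have -> : [set enum_val i | i : 'I_#|vertices C| & v 0 i != 0] :&: e = enum_val @: B.
  apply/setP => t; rewrite inE; apply/andP/imsetP.
    by case=> /imsetP[i]; rewrite inE => vi -> ie; exists i; rewrite ?inE ?vi.
  by case=> i; rewrite inE => /andP[vi ie] ->; split=> //; rewrite imset_f ?inE.
rewrite card_imset; last exact: enum_val_inj.
have sumB : \sum_(i in B) v 0 i = 1.
  rewrite -(vA (enum_rank_in eC e)) mul_incidence enum_rankK_in //.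
  rewrite [RHS](bigID (fun i => v 0 i == 0)) /=.
  rewrite [X in _ = X + _]big1 ?add0r => [|i /andP[_ /eqP] //].
  by apply: eq_bigl => i; rewrite inE andbC.
(* The entries of [v] over [B] sum to 1 and each is at least 1 by integrality, so [B] has at most
   one element; it is nonempty because an empty sum is 0. *)
apply/eqP; rewrite eqn_leq; apply/andP; split.
  rewrite -(ler_nat R) -[leRHS]sumB -sum1_card natr_sum.
  by apply: ler_sum => i; rewrite inE => /andP[/v1].
rewrite lt0n; apply/eqP => /cards0_eq B0; move: sumB; rewrite B0 big_set0.
by move/esym/eqP; rewrite oner_eq0.
Qed.

End Fractional.

Theorem proposition2p6 (R : realType) (T : finType) (d : nat) (C : clutter T)
    (noiso : no_isolated_vertices C)
    (unif : uniform d C)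
    (matching : has_perfect_matching C)
    (integral :
       integral_polyhedron (set_covering_polyhedron (incidence_matrix R C))) :
  vertex_critical C.
Proof.
move=> x xV; have [M [MC tM cM]] := matching.
have [K [KV xK K1]] := exact_cover_through R T C d x noiso unif integral xV.
have C0 : set0 \notin edges C.
  by apply/negP => /K1; rewrite setI0 cards0.
apply: leq_trans (matching_le_alpha0 T C M C0 MC tM cM).
have cardK : #|K| = #|M|.
  rewrite (card_trivIset_cover T K M) ?cM // -sum1_card.
  by apply: eq_bigr => e eM; rewrite K1 // (subsetP MC).
rewrite -cardK (cardsD1 x K) xK add1n ltnS; apply: alpha0_le.
apply/andP; split; first exact: setSD.
apply/forall_inP => e; rewrite inE => /andP[eC xe].
(* The surviving edges avoid [x], so [K :\ x] still meets them. *)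
have -> : (K :\ x) :&: e = K :&: e.
  rewrite setIDAC; apply/setDidPl.
  by rewrite disjoint_sym disjoints1 inE (negPf xe) andbF.
by rewrite -card_gt0 K1.
Qed.
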